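(* Suppose $a,b\in\ell^\infty(\mathbb{Z})$ are complex-valued sequences with $a(n)\ne0$ for all $n\in\mathbb{Z}$ and $$\{a(n)^2-\tfrac14\}_{n\in\mathbb{Z}},\ \{b(n)\}_{n\in\mathbb{Z}}\in\ell^1(\mathbb{Z}).$$ Let $c_1,c_2,\dots\in\mathbb{C}$ be fixed constants and let $p,r\in\mathbb{N}_{-1}$. Then $$\{I_p,I_r\}=0,$$ that is, $I_p$ and $I_r$ are in involution for all $p,r\in\mathbb{N}_{-1}$.
   Context: $\mathbb{N}=\{1,2,\dots\}$, $\mathbb{N}_0=\mathbb{N}\cup\{0\}$, $\mathbb{N}_{-1}=\mathbb{N}\cup\{0,-1\}$. For a sequence $c$ on $\mathbb{Z}$, $(S^{\pm}c)(n)=c^{\pm}(n)=c(n\pm1)$, and for $s\in\mathbb{Z}$, $(S^{(s)}c)(n)=c^{(s)}(n)=c(n+s)$. Let $L=aS^++a^-S^-+b$ and $$\hat f_\ell(n)=(\delta_n,L^\ell\delta_n)_{\ell^2(\mathbb{Z})},\qquad\ell\in\mathbb{N}_0,$$ where $\delta_n$ is the standard basis of $\ell^2(\mathbb{Z})$. Each $\hat f_\ell$ is a fixed ($n$-independent) polynomial in $a,b$ and finitely many of their shifts. Under the stated hypotheses the limit $\lambda_\ell=\lim_{|n|\to\infty}\hat f_\ell(n)$ exists and $\{\hat f_\ell(n)-\lambda_\ell\}_{n\in\mathbb{Z}}\in\ell^1(\mathbb{Z})$. With $c_0=1$ set $$\widehat I_q=\frac1{q+2}\sum_{n\in\mathbb{Z}}\big(\hat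 f_{q+2}(n)-\lambda_{q+2}\big)\ (q\in\mathbb{N}_{-1}),\qquad I_{-1}=\widehat I_{-1},\qquad I_p=\sum_{k=0}^{p}c_{p-k}\widehat I_k\ (p\in\mathbb{N}_0).$$ Variational derivative: if $F$ is a polynomial of $a,b$ and the shifts $a^{(\pm1)},b^{(\pm1)},\dots,a^{(\pm k)},b^{(\pm k)}$, regarded as independent variables, then for $u\in\{a,b\}$, $\frac{\delta F}{\delta u}=\sum_{s=-k}^{k}S^{(-s)}\frac{\partial F}{\partial u^{(s)}}$. Poisson bracket: for functionals $\mathcal{F}_i(a,b)=\sum_{n\in\mathbb{Z}}F_i(n)$ with densities $F_i$ of this type (up to additive constants making the series converge), $i=1,2$, $$\{\mathcal{F}_1,\mathcal{F}_2\}=\sum_{n\in\mathbb{Z}}\begin{pmatrix}\frac{\delta F_1}{\delta a}(n)\\ \frac{\delta F_1}{\delta b}(n)\end{pmatrix}\cdot\left(D\begin{pmatrix}\frac{\delta F_2}{\delta a}\\ \frac{\delta F_2}{\delta b}\end{pmatrix}\right)(n),\qquad D=\begin{pmatrix}0&aS^+-a\\ a-a^-S^-&0\end{pmatrix},$$ where $\cdot$ is the bilinear product $u\cdot v=u_1v_1+u_2v_2$ on $\mathbb{C}^2$ (no complex conjugation). *)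

(* Defs.v *)
From HB Require Import structures.
From mathcomp Require Import all_boot all_order all_algebra.
From mathcomp Require Import complex mpoly finmap.
From mathcomp Require Import boolp classical_sets functions reals ereal topology.
From mathcomp Require Import normedtype sequences esum.
From mathcomp Require summability.
From mathcomp Require Import zify.

Set Implicit Arguments.
Unset Strict Implicit.
Unset Printing Implicit Defensive.

Import Order.TTheory GRing.Theory Num.Theory.
Import numFieldNormedType.Exports.

Local Open Scope classical_set_scope.
Local Open Scope ring_scope.

Section Jacobi.
Variable A : comPzRingType.
Implicit Types (a b f : int -> A).

(* L = a S^+ + a^- S^- + b. *)
Definition jacobi a b f : int -> A :=
  fun n => a n * f (n + 1) + a (n - 1) * f (n - 1) + b n * f n.

Definition delta (n : int) : int -> A := fun m => (m == n)%:R.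

(* (delta_n, L^l delta_n) is the n-th coordinate of L^l delta_n. The coefficient
   ring is arbitrary so that the same formula produces both the sequence (A = C)
   and the polynomial it comes from (A a polynomial ring, see [fhat_poly]). *)
Definition fhat a b (l : nat) (n : int) : A := iter l (jacobi a b) (delta n) n.

End Jacobi.

(* A density of order k is a polynomial in the 2(2k+1) independent variables
   a^(s), b^(s), |s| <= k. The j-th variable of each block, j < 2k+1, stands for
   the shift by s = j - k; the block of a comes first. *)
Definition nvar (k : nat) : nat := ((k + k).+1 + (k + k).+1)%N.

Notation density_poly C k := {mpoly C[nvar k]}.

Section Densities.
Variable C : comNzRingType.
Implicit Types (a b : int -> C) (k : nat).

Definition shift_of k (j : 'I_(k + k).+1) : int := j%:Z - k%:Z.

Definition idx_a k (j : 'I_(k + k).+1) : 'I_(nvar k) := lshift (k + k).+1 j.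
Definition idx_b k (j : 'I_(k + k).+1) : 'I_(nvar k) := rshift (k + k).+1 j.

(* The variables a^(s) and b^(s); 0 outside the window |s| <= k. *)
Definition var_a k (s : int) : density_poly C k :=
  if (`|s|%N <= k)%N then 'X_(idx_a (inord `|(s + k%:Z)%R|%N)) else 0.
Definition var_b k (s : int) : density_poly C k :=
  if (`|s|%N <= k)%N then 'X_(idx_b (inord `|(s + k%:Z)%R|%N)) else 0.

(* F(n): substitute a(n + s) for a^(s) and b(n + s) for b^(s). *)
Definition density_at k a b (n : int) (F : density_poly C k) : C :=
  F.@[fun i : 'I_(nvar k) => match fintype.split i with
      | inl j => a (n + shift_of j)
      | inr j => b (n + shift_of j)
      end].

(* n |-> sum_s (S^(-s) dF/du^(s))(n), for u = a and u = b. *)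
Definition vder_a k (F : density_poly C k) a b (n : int) : C :=
  \sum_(j < (k + k).+1) density_at a b (n - shift_of j) (F^`M(idx_a j)).
Definition vder_b k (F : density_poly C k) a b (n : int) : C :=
  \sum_(j < (k + k).+1) density_at a b (n - shift_of j) (F^`M(idx_b j)).

(* The polynomial of which fhat_l is the evaluation; the window is large enough
   when l <= k (lemma [fhat_polyE]). *)
Definition fhat_poly k (l : nat) : density_poly C k :=
  fhat (var_a k) (var_b k) l 0.

(* The functional (a, b) |-> sum_n (F(n) - offset), F a density of order
   [order]. *)
Record functional := Functional {
  order : nat;
  density : density_poly C order;
  offset : (int -> C) -> (int -> C) -> C
}.

(* The terms of the series {F1, F2}. *)
Definition bracket_term (F1 F2 : functional) a b (n : int) : C :=
  let x1 := vder_a (density F1) a b in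
  let y1 := vder_b (density F1) a b in
  let x2 := vder_a (density F2) a b in
  let y2 := vder_b (density F2) a b in
  x1 n * (a n * y2 (n + 1) - a n * y2 n)
  + y1 n * (a n * x2 n - a (n - 1) * x2 (n - 1)).

End Densities.

Section Functionals.
Variable R : realType.
Implicit Types (a b f : int -> R[i]).

(* [R[i]^o] is R[i] with its usual topology. *)
Definition ell_infty f : Prop := bounded_fun (f : int -> R[i]^o).

Definition ell1 f : Prop :=
  summable [set: int] (fun n => (complex.Re `|f n|)%:E).

(* Unconditional convergence of a series over Z, and its sum. *)
Definition cvgZ f : Prop :=
  cvg (summability.partial_sum (f : int -> R[i]^o) @ summability.totally).

Definition sumZ f : R[i] := summability.sum (f : int -> R[i]^o).

(* |n| --> oo *)
Definition inftyZ : set_system int :=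
  filter_from [set: nat] (fun N => [set n : int | (N <= `|n|)%N]).

Definition lambda a b (l : nat) : R[i] :=
  lim ((fhat a b l : int -> R[i]^o) @ inftyZ).

Definition fval (F : functional R[i]) a b : R[i] :=
  sumZ (fun n => density_at a b n (density F) - offset F a b).

(* These are meant for q >= -1, so that |q + 2| = q + 2 >= 1. *)
Definition Ihat_density k (q : int) : density_poly R[i] k :=
  (`|(q + 2)%R|%N)%:R^-1 *: fhat_poly R[i] k `|(q + 2)%R|%N.
Definition Ihat_offset (q : int) a b : R[i] :=
  (`|(q + 2)%R|%N)%:R^-1 * lambda a b `|(q + 2)%R|%N.

Definition Ihat (q : int) : functional R[i] :=
  Functional (Ihat_density `|(q + 2)%R|%N q) (Ihat_offset q).

(* p is meant to be >= -1: the second case is p = -1. *)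
Definition Ifun (c : nat -> R[i]) (p : int) : functional R[i] :=
  match p with
  | Posz m => Functional
      (\sum_(j < m.+1) c (m - j)%N *: Ihat_density m.+2 j%:Z)
      (fun a b => \sum_(j < m.+1) c (m - j)%N * Ihat_offset j%:Z a b)
  | Negz _ => Ihat (-1)
  end.

Definition poisson_bracket (F1 F2 : functional R[i]) a b : R[i] :=
  sumZ (bracket_term F1 F2 a b).

End Functionals.

Section Consistency.

Lemma iter_jacobi_supp (A : comPzRingType) (a b : int -> A) (l : nat) (n m : int) :
  (l < `|(m - n)%R|)%N -> iter l (jacobi a b) (delta A n) m = 0.
Proof.
elim: l m => [|l IH] m lm /=.
  by rewrite /delta; case: eqP lm => // ->; rewrite subrr.
rewrite /jacobi !IH ?mulr0 ?addr0 //; lia.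
Qed.

Lemma iter_jacobi_morph (A B : comPzRingType) (g : {rmorphism A -> B})
    (a b : int -> A) (a' b' : int -> B) (n : int) (l k : nat) (m : int) :
  (forall s : int, (`|s|%N <= k)%N -> g (a s) = a' (n + s)) ->
  (forall s : int, (`|s|%N <= k)%N -> g (b s) = b' (n + s)) ->
  (l <= k)%N ->
  g (iter l (jacobi a b) (delta A 0) m) = iter l (jacobi a' b') (delta B n) (n + m).
Proof.
move=> ga gb; elim: l m => [|l IH] m lk /=.
  by rewrite /delta rmorph_nat -subr_eq0 subr0 -[in RHS]subr_eq0 [n + m]addrC addrK.
rewrite /jacobi !rmorphD !rmorphM !IH ?(ltnW lk) // !addrA.
case: (leqP `|m|%N l.+1) => ml; last first.
  have H s : (l < `|s|)%N -> iter l (jacobi a' b') (delta B n) (n + s) = 0.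
    by move=> ls; apply: iter_jacobi_supp; rewrite addrC addKr.
  rewrite -!addrA !H ?mulr0 //; lia.
rewrite ga ?gb; [|lia|lia].
have [h|h] := leqP `|(m - 1)%R|%N l; first by rewrite ga ?addrA//; lia.
by rewrite -(addrA n m (-1)) (@iter_jacobi_supp _ a' b' l n (n + (m - 1))) ?mulr0 // addrC addKr.
Qed.

Lemma density_at_var_a (C : comNzRingType) (a b : int -> C) k (n s : int) :
  (`|s|%N <= k)%N -> density_at a b n (var_a C k s) = a (n + s).
Proof.
move=> sk; rewrite /var_a sk /density_at mevalXU.
rewrite /idx_a -[lshift _ _]/(unsplit (inl _)) unsplitK /shift_of inordK; last lia.
by congr (a (n + _)); lia.
Qed.

Lemma density_at_var_b (C : comNzRingType) (a b : int -> C) k (n s : int) :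
  (`|s|%N <= k)%N -> density_at a b n (var_b C k s) = b (n + s).
Proof.
move=> sk; rewrite /var_b sk /density_at mevalXU.
rewrite /idx_b -[rshift _ _]/(unsplit (inr _)) unsplitK /shift_of inordK; last lia.
by congr (b (n + _)); lia.
Qed.

Lemma fhat_polyE (C : comNzRingType) (a b : int -> C) k l (n : int) :
  (l <= k)%N -> density_at a b n (fhat_poly C k l) = fhat a b l n.
Proof.
move=> lk; rewrite /fhat_poly /fhat /density_at.
rewrite (@iter_jacobi_morph _ _ _ _ _ a b n l k) ?addr0 // => s sk.
  exact: density_at_var_a.
exact: density_at_var_b.
Qed.

Lemma fval_Ihat (R : realType) (a b : int -> R[i]) (q : int) :
  fval (Ihat R q) a b = sumZ (fun n =>
    (`|(q + 2)%R|%N)%:R^-1 * (fhat a b `|(q + 2)%R|%N n - lambda a b `|(q + 2)%R|%N)).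
Proof.
congr sumZ; apply/funext => n /=.
by rewrite /density_at mevalZ -/(density_at _ _ _ _) fhat_polyE // mulrBr.
Qed.

Lemma fval_Ifun (R : realType) (a b : int -> R[i]) (c : nat -> R[i]) (p : nat) :
  fval (Ifun c p%:Z) a b = sumZ (fun n => \sum_(k < p.+1) c (p - k)%N *
    (k.+2%:R^-1 * (fhat a b k.+2 n - lambda a b k.+2))).
Proof.
congr sumZ; apply/funext => n /=.
rewrite /density_at raddf_sum /= -sumrB; apply: eq_bigr => k _.
rewrite !mevalZ -/(density_at _ _ _ _) /Ihat_offset -mulrBr.
have -> : `|(k%:Z + 2)%R|%N = k.+2 by lia.
by rewrite fhat_polyE ?mulrBr // !ltnS -ltnS.
Qed.

End Consistency.

(* Main.v *)
From mathcomp Require Import all_boot all_order all_algebra.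
From mathcomp Require Import complex mpoly finmap.
From mathcomp Require Import boolp classical_sets cardinality fsbigop.
From mathcomp Require Import reals ereal topology normedtype esum.
From mathcomp Require summability.
From mathcomp Require Import zify ring.
(* Last, so that [cvgZ] is not the lemma of that name in normedtype. *)
Require Import Defs.

(** For a site [n] put [G_l(n) = (L^l)(n, n)] and [K_l(n) = a(n) (L^l)(n, n + 1)].
    The gradient of the functional with density [fhat_(l+1) / (l + 1)] is
    [(2 (L^l)(n, n + 1), G_l(n))], so the terms of [{I_p, I_r}] are linear
    combinations of [B(l, m) = K_l (G_m^+ - G_m) + G_l (K_m - K_m^-)].
    Modulo differences [T(n + 1) - T(n)], [B(l, m)] is skew in [(l, m)], and by the
    recursion for [G] and [K] so is [B(l, m + 1)] (the second Hamiltonian structure).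
    Hence [B(l, m + 1) = B(l + 1, m)] and, descending to [B(l + m, 0) = 0], each
    [B(l, m)] is a difference.  Finally [T] is a polynomial in shifts of [a^2] and
    [b], so it differs from a constant by an [l^1] sequence, and the sum telescopes
    to 0. *)

Set Implicit Arguments.
Unset Strict Implicit.
Unset Printing Implicit Defensive.

Import Order.TTheory GRing.Theory Num.Theory.
Import numFieldNormedType.Exports.

Local Open Scope ring_scope.

(** * Entries of the powers of [L], and the flux of the bracket *)

Section JacobiPowers.
Variable A : comNzRingType.
Implicit Types (a b : int -> A) (l : nat) (m n : int).

(** Entries of [L ^ l], over any commutative ring so that the same identities serve sequences and
    formal variables. *)
Definition jpow a b l m n : A := iter l (jacobi a b) (delta A n) m.
Arguments jpow : simpl never.

Lemma jpow0 a b m n : jpow a b 0 m n = (m == n)%:R.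
Proof. by []. Qed.

Lemma jpowS a b l m n : jpow a b l.+1 m n =
  a m * jpow a b l (m + 1) n + a (m - 1) * jpow a b l (m - 1) n
  + b m * jpow a b l m n.
Proof. by []. Qed.

(** Peels [L] off on the right, where [jpowS] peels it off on the left; the base case is the
    symmetry of the matrix of [L]. *)
Lemma jpowSr a b l m n : jpow a b l.+1 m n =
  a n * jpow a b l m (n + 1) + a (n - 1) * jpow a b l m (n - 1)
  + b n * jpow a b l m n.
Proof.
elim: l m n => [|l IH] m n; last first.
  by rewrite !(jpowS _ _ l m) (jpowS _ _ l.+1) (IH (m + 1)) (IH (m - 1)) (IH m n); ring.
rewrite jpowS !jpow0 -(subr_eq m n 1) (eq_sym m (n - 1)) (subr_eq n m 1).
rewrite (eq_sym n) [X in X + _ = _]addrC; congr (_ + _ + _).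
- by have [<-|_] := eqVneq (m - 1) n; rewrite ?mulr0.
- by have [<-|_] := eqVneq (m + 1) n; rewrite ?addrK ?mulr0.
- by have [<-|_] := eqVneq m n; rewrite ?mulr0.
Qed.

Lemma jpow_sym a b l m n : jpow a b l m n = jpow a b l n m.
Proof.
elim: l m n => [|l IH] m n; first by rewrite !jpow0 eq_sym.
by rewrite jpowS jpowSr !(IH n).
Qed.

(* The window of radius [k] about [n] contains every intermediate site of a path of
   length [i] starting at [p]. *)
Lemma jpowD_window a b k i h n p q : (`|(p - n)%R| + i <= k)%N ->
  \sum_(j < (k + k).+1)
     jpow a b i p (n - shift_of j) * jpow a b h (n - shift_of j) q =
  jpow a b (i + h) p q.
Proof.
elim: i p => [|i IH] p hp.
  have jk : (`|(n - p + k%:Z)%R| < (k + k).+1)%N by lia.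
  have sj : n - shift_of (Ordinal jk) = p by rewrite /shift_of /=; lia.
  rewrite (bigD1 (Ordinal jk)) //= sj jpow0 eqxx mul1r big1 ?addr0 // => j jj.
  rewrite jpow0 (_ : (p == _) = false) ?mul0r //; apply/negbTE.
  apply: contra jj => /eqP pj; apply/eqP/val_inj; rewrite /= /shift_of in pj *.
  lia.
under eq_bigr do rewrite jpowS !mulrDl -!mulrA.
by rewrite !big_split /= -!mulr_sumr !IH ?addSn ?jpowS //; lia.
Qed.

(** Leibniz rule: [D (L ^ l)] is the sum of the [L ^ i (D L) L ^ (l - i - 1)], and [D L] has only
    the entries [u] at [(j, j + 1)] and [(j + 1, j)], and [v] at [(j, j)]. *)
Lemma jpow_derivation a b (D : {additive A -> A}) (u v : A) (j : int) l m :
  (forall x y, D (x * y) = D x * y + x * D y) ->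
  (forall s, D (a s) = u * (s == j)%:R) ->
  (forall s, D (b s) = v * (s == j)%:R) ->
  D (jpow a b l m 0) = \sum_(i < l)
    (u * (jpow a b i m j * jpow a b (l - i.+1) (j + 1) 0
          + jpow a b i m (j + 1) * jpow a b (l - i.+1) j 0)
     + v * (jpow a b i m j * jpow a b (l - i.+1) j 0)).
Proof.
move=> DM Da Db; elim: l m => [|l IH] m.
  have D1 : D 1 = 0.
    by apply: (@addrI _ (D 1)); rewrite -{3}(mulr1 1) DM mulr1 mul1r addr0.
  by rewrite big_ord0 jpow0; case: (m == 0); rewrite ?D1 ?raddf0.
rewrite jpowS !raddfD /= !DM !Da !Db !IH big_ord_recl /= !jpow0 subn1 /=.
(* The term [i = 0] has been split off; the others are [L], acting on the row index, applied to the
   inductive sums. *)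
rewrite [X in _ = _ + X](_ : _ =
  a m * \sum_(i < l)
    (u * (jpow a b i (m + 1) j * jpow a b (l - i.+1) (j + 1) 0
          + jpow a b i (m + 1) (j + 1) * jpow a b (l - i.+1) j 0)
     + v * (jpow a b i (m + 1) j * jpow a b (l - i.+1) j 0)) +
  a (m - 1) * \sum_(i < l)
    (u * (jpow a b i (m - 1) j * jpow a b (l - i.+1) (j + 1) 0
          + jpow a b i (m - 1) (j + 1) * jpow a b (l - i.+1) j 0)
     + v * (jpow a b i (m - 1) j * jpow a b (l - i.+1) j 0)) +
  b m * \sum_(i < l)
    (u * (jpow a b i m j * jpow a b (l - i.+1) (j + 1) 0
          + jpow a b i m (j + 1) * jpow a b (l - i.+1) j 0)
     + v * (jpow a b i m j * jpow a b (l - i.+1) j 0))); last first.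
  rewrite !mulr_sumr -!big_split; apply: eq_bigr => i _ /=.
  by rewrite /bump /= !add1n subSS !(jpowS _ _ i); ring.
have -> : (m == j)%:R * jpow a b l (j + 1) 0 = (m == j)%:R * jpow a b l (m + 1) 0.
  by case: eqP => [->|]; rewrite ?mul0r.
have -> : (m == j + 1)%:R * jpow a b l j 0 = (m - 1 == j)%:R * jpow a b l (m - 1) 0.
  by rewrite -subr_eq; case: eqP => [->|]; rewrite ?mul0r.
have -> : (m == j)%:R * jpow a b l j 0 = (m == j)%:R * jpow a b l m 0.
  by case: eqP => [->|]; rewrite ?mul0r.
by ring.
Qed.

Definition jdiag a b l n := jpow a b l n n.
Definition joff a b l n := a n * jpow a b l n (n + 1).

Lemma jdiagS a b l n : jdiag a b l.+1 n =
  joff a b l n + joff a b l (n - 1) + b n * jdiag a b l n.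
Proof. by rewrite /jdiag /joff jpowS subrK (jpow_sym _ _ _ (n + 1)). Qed.

(** Both off-diagonal entries are expanded at their common site [n]. The entry of [L ^ l] joining
    [n - 1] and [n + 1] occurs in both with coefficient [a (n - 1) * a n] and cancels, so the
    recursion closes in [G] and [K]. *)
Lemma joffS a b l n : joff a b l.+1 n - joff a b l.+1 (n - 1) =
  a n ^+ 2 * jdiag a b l (n + 1) - a (n - 1) ^+ 2 * jdiag a b l (n - 1)
  + b n * (joff a b l n - joff a b l (n - 1)).
Proof.
rewrite /joff /jdiag subrK (jpowSr _ _ _ (n - 1)) [jpow a b _ n _]jpow_sym.
by rewrite jpowSr (jpow_sym _ _ _ (n + 1) (n - 1)) (jpow_sym _ _ _ (n + 1) n); ring.
Qed.

Definition jbracket a b l1 l2 n :=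
  joff a b l1 n * (jdiag a b l2 (n + 1) - jdiag a b l2 n)
  + jdiag a b l1 n * (joff a b l2 n - joff a b l2 (n - 1)).

Lemma jbracket0 a b l n : jbracket a b l 0 n = 0.
Proof.
have nS (i : int) : (i == i + 1) = false by apply/eqP; lia.
by rewrite /jbracket /joff /jdiag !jpow0 !eqxx !nS !mulr0 !subrr !mulr0 addr0.
Qed.

Definition sym_flux a b l1 l2 n :=
  joff a b l2 (n - 1) * jdiag a b l1 n + joff a b l1 (n - 1) * jdiag a b l2 n.

(** Skew-adjointness of the first Hamiltonian operator: the products [K G] taken at the same site
    cancel, and what is left is a difference. *)
Lemma jbracket_sym a b l1 l2 n : jbracket a b l1 l2 n + jbracket a b l2 l1 n =
  sym_flux a b l1 l2 (n + 1) - sym_flux a b l1 l2 n.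
Proof. by rewrite /jbracket /sym_flux !addrK; ring. Qed.

Definition symS_flux a b l1 l2 n :=
  joff a b l1 (n - 1) * joff a b l2 n + joff a b l2 (n - 1) * joff a b l1 n
  + b n * (joff a b l1 (n - 1) * jdiag a b l2 n
           + joff a b l2 (n - 1) * jdiag a b l1 n)
  + a (n - 1) ^+ 2 * (jdiag a b l1 (n - 1) * jdiag a b l2 n
                      + jdiag a b l2 (n - 1) * jdiag a b l1 n).

(** Lowering the raised index by [joffS] and [jdiagS] gives the second Hamiltonian form in [l1] and
    [l2], again skew up to a difference. *)
Lemma jbracketS_sym a b l1 l2 n :
  jbracket a b l1 l2.+1 n + jbracket a b l2 l1.+1 n =
  symS_flux a b l1 l2 (n + 1) - symS_flux a b l1 l2 n.
Proof. by rewrite /jbracket /symS_flux !joffS !jdiagS !addrK; ring. Qed.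

(** [jbracketS_sym] at [(l1, l)] and [jbracket_sym] at [(l1.+1, l)] share the term [B(l, l1 + 1)];
    eliminating it passes from [B(l1, l + 1)] to [B(l1 + 1, l)] at the cost of these two fluxes. *)
Fixpoint jflux a b l1 l2 n := if l2 is l.+1 then
  jflux a b l1.+1 l n + symS_flux a b l1 l n - sym_flux a b l1.+1 l n else 0.

Lemma jbracket_flux a b l1 l2 n :
  jbracket a b l1 l2 n = jflux a b l1 l2 (n + 1) - jflux a b l1 l2 n.
Proof.
elim: l2 l1 => [|l IH] l1; first by rewrite jbracket0 subrr.
have := jbracketS_sym a b l1 l n; have := jbracket_sym a b l1.+1 l n.
rewrite IH /= => /eqP; rewrite addrC -subr_eq => /eqP <- /eqP.
by rewrite -subr_eq opprK => /eqP <-; ring.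
Qed.

End JacobiPowers.

(** * Sequences that differ from a constant by a summable one *)

Section AbsSummable.
Variable K : numFieldType.
Implicit Types f g : int -> K.

(** Bounding finite sums by an element of [K] keeps the algebra below free of limits;
    [ell1_abs_summable] makes the link with [ell1]. *)
Definition abs_summable f :=
  exists M : K, forall J : {fset int}, \sum_(i <- J) `|f i| <= M.

Lemma abs_summable_le f g (c : K) : (forall n, `|g n| <= c * `|f n|) ->
  0 <= c -> abs_summable f -> abs_summable g.
Proof.
move=> gf c0 [M fM]; exists (c * M) => J.
apply: le_trans (ler_wpM2l c0 (fM J)); rewrite mulr_sumr.
by apply: ler_sum => i _; exact: gf.
Qed.

Lemma abs_summableD f g : abs_summable f -> abs_summable g ->
  abs_summable (fun n => f n + g n).
Proof.
move=> [M fM] [N gN]; exists (M + N) => J; apply: le_trans (lerD (fM J) (gN J)).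
by rewrite -big_split; apply: ler_sum => i _; exact: ler_normD.
Qed.

Lemma abs_summableZ c f : abs_summable f -> abs_summable (fun n => c * f n).
Proof. by apply: (@abs_summable_le _ _ `|c|) => // n; rewrite normrM. Qed.

Lemma abs_summable_shift f (s : int) :
  abs_summable f -> abs_summable (fun n => f (n + s)).
Proof.
move=> [M fM]; exists M => J.
have := fM [fset (i + s)%R | i in J]%fset.
by rewrite big_imfset //= => i j _ _; exact: addIr.
Qed.

Lemma abs_summable_bounded f :
  abs_summable f -> exists2 M : K, 0 <= M & forall n, `|f n| <= M.
Proof.
move=> [M fM]; have fb n : `|f n| <= M by have := fM [fset n]%fset; rewrite big_seq_fset1.
by exists M => //; apply: le_trans (fb 0).
Qed.

(** These sequences form a shift-invariant ring containing the constants, hence closed under the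
    polynomials that define the flux. *)
Definition ell1_const f := exists lam : K, abs_summable (fun n => f n - lam).

Lemma ell1_constE f g : f =1 g -> ell1_const f -> ell1_const g.
Proof. by move=> /funext ->. Qed.

Lemma ell1_const_cst (c : K) : ell1_const (fun=> c).
Proof.
exists c; exists 0 => J; rewrite big1 // => i _.
by rewrite subrr normr0.
Qed.

Lemma ell1_constD f g : ell1_const f -> ell1_const g ->
  ell1_const (fun n => f n + g n).
Proof.
move=> [lam flam] [mu gmu]; exists (lam + mu).
have := abs_summableD flam gmu; congr abs_summable; apply/funext => n.
by rewrite opprD addrACA.
Qed.

(** With [x = f - lam] and [y = g - mu], the product is [lam * mu + x * y + lam * y + mu * x], and
    [x * y] is summable because [x] is bounded. *)
Lemma ell1_constM f g : ell1_const f -> ell1_const g ->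
  ell1_const (fun n => f n * g n).
Proof.
move=> [lam flam] [mu gmu]; exists (lam * mu).
have [M M0 fM] := abs_summable_bounded flam.
have fg : abs_summable (fun n => (f n - lam) * (g n - mu)).
  by apply: (abs_summable_le _ M0 gmu) => n; rewrite normrM ler_wpM2r.
have := abs_summableD (abs_summableD fg (abs_summableZ lam gmu))
  (abs_summableZ mu flam).
by congr abs_summable; apply/funext => n; ring.
Qed.

Lemma ell1_constN f : ell1_const f -> ell1_const (fun n => - f n).
Proof.
move=> /(ell1_constM (ell1_const_cst (-1))).
by apply: ell1_constE => n; rewrite mulN1r.
Qed.

Lemma ell1_const_shift f (s : int) :
  ell1_const f -> ell1_const (fun n => f (n + s)).
Proof. by move=> [lam /(abs_summable_shift s) ?]; exists lam. Qed.

Lemma ell1_const_sum (I : finType) (F : I -> int -> K) :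
  (forall i, ell1_const (F i)) -> ell1_const (fun n => \sum_i F i n).
Proof.
move=> hF; elim: (index_enum I) => [|i s IH].
  by apply: ell1_constE (ell1_const_cst 0) => n; rewrite big_nil.
by apply: ell1_constE (ell1_constD (hF i) IH) => n; rewrite big_cons.
Qed.

Variables a b : int -> K.
Hypotheses (ha : ell1_const (fun n => a n ^+ 2)) (hb : ell1_const b).

(* Only [a ^ 2] has a limit at infinity: an off-diagonal entry of [L ^ l] must be
   multiplied by the [a]'s along the way to become a polynomial in [a ^ 2], [b]. *)
Lemma ell1_const_jpow l s :
  ell1_const (fun n => jpow a b l n (n + s%:Z) * \prod_(j < s) a (n + j%:Z)).
Proof.
have hb' f : ell1_const f -> ell1_const (fun n => b n * f n) by exact: ell1_constM.
elim: l s => [|l IH] [|s].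
- by apply: ell1_constE (ell1_const_cst 1) => n;
    rewrite big_ord0 mulr1 jpow0 addr0 eqxx.
- apply: ell1_constE (ell1_const_cst 0) => n.
  by rewrite jpow0 -subr_eq0 opprD addNKr oppr_eq0 mul0r.
- apply: ell1_constE (ell1_constD (ell1_constD (IH 1%N)
    (ell1_const_shift (-1) (IH 1%N))) (hb' _ (IH 0%N))) => n.
  rewrite !big_ord1 !big_ord0 !addr0 !mulr1 subrK jpowS (jpow_sym _ _ _ (n + 1)).
  by ring.
(* A step towards the target pairs [a n] with the first factor of the product, giving [a n ^+ 2]; a
   step away prepends the factor [a (n - 1)]. *)
- apply: ell1_constE (ell1_constD (ell1_constD
    (ell1_constM ha (ell1_const_shift 1 (IH s)))
    (ell1_const_shift (-1) (IH s.+2))) (hb' _ (IH s.+1))) => n.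
  rewrite jpowS !(big_ord_recl s) (big_ord_recl s.+1) (big_ord_recl s) /= !addr0.
  have -> : n + 1 + s%:Z = n + s.+1%:Z by lia.
  have -> : n - 1 + s.+2%:Z = n + s.+1%:Z by lia.
  have -> : n - 1 + (bump 0 0)%:Z = n by rewrite /bump /=; lia.
  have -> : \prod_(i < s) a (n - 1 + (bump 0 (bump 0 i))%:Z) =
            \prod_(i < s) a (n + (bump 0 i)%:Z).
    by apply: eq_bigr => i _; congr (a _); rewrite /bump /=; lia.
  have -> : \prod_(i < s) a (n + 1 + i%:Z) = \prod_(i < s) a (n + (bump 0 i)%:Z).
    by apply: eq_bigr => i _; congr (a _); rewrite /bump /=; lia.
  by ring.
Qed.

Lemma ell1_const_jdiag l : ell1_const (jdiag a b l).
Proof.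
by apply: ell1_constE (ell1_const_jpow l 0) => n; rewrite big_ord0 mulr1 addr0.
Qed.

Lemma ell1_const_joff l : ell1_const (joff a b l).
Proof.
by apply: ell1_constE (ell1_const_jpow l 1) => n; rewrite big_ord1 addr0 mulrC.
Qed.

Lemma ell1_const_sym_flux l1 l2 : ell1_const (sym_flux a b l1 l2).
Proof.
by apply: ell1_constD; apply: ell1_constM;
  solve [exact: ell1_const_jdiag | exact: (ell1_const_shift (-1) (ell1_const_joff _))].
Qed.

Lemma ell1_const_symS_flux l1 l2 : ell1_const (symS_flux a b l1 l2).
Proof.
have hG := ell1_const_jdiag; have hK := ell1_const_joff.
have hG' l := ell1_const_shift (-1) (hG l).
have hK' l := ell1_const_shift (-1) (hK l).
apply: ell1_constD; first apply: ell1_constD.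
- by apply: ell1_constD; apply: ell1_constM.
- by apply: ell1_constM => //; apply: ell1_constD; apply: ell1_constM.
- apply: ell1_constM; first exact: (ell1_const_shift (-1) ha).
  by apply: ell1_constD; apply: ell1_constM.
Qed.

Lemma ell1_const_jflux l1 l2 : ell1_const (jflux a b l1 l2).
Proof.
elim: l2 l1 => [|l IH] l1; first exact: ell1_const_cst.
apply: (@ell1_constD (fun n => jflux a b l1.+1 l n + symS_flux a b l1 l n)
  (fun n => - sym_flux a b l1.+1 l n)).
  by apply: ell1_constD => //; exact: ell1_const_symS_flux.
by apply: ell1_constN; exact: ell1_const_sym_flux.
Qed.

End AbsSummable.

(** * Variational derivatives of the densities *)

Section VariationalDerivatives.
Variable C : comNzRingType.
Implicit Types (a b : int -> C) (k l : nat) (n m s : int).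

Lemma mderivXU N (i j : 'I_N) : ('X_i : {mpoly C[N]})^`M(j) = (i == j)%:R.
Proof.
rewrite mderivX mnm1E; case: eqP => [->|_]; last by rewrite scale0r.
by rewrite -{1}[U_(j)%MM]add0m addmK mpolyX0 scale1r.
Qed.

Lemma inord_shiftE k s (j : 'I_(k + k).+1) : (`|s|%N <= k)%N ->
  (inord `|(s + k%:Z)%R|%N == j) = (s == shift_of j).
Proof.
move=> sk; apply/eqP/eqP => [<-|->]; rewrite /shift_of.
  by rewrite inordK; lia.
by apply: val_inj; rewrite /= inordK; have := ltn_ord j; lia.
Qed.

Lemma shift_of_le k (j : 'I_(k + k).+1) : (`|shift_of j| <= k)%N.
Proof. by have := ltn_ord j; rewrite /shift_of; lia. Qed.

Lemma mderiv_var_a_a k s (j : 'I_(k + k).+1) :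
  (var_a C k s)^`M(idx_a j) = (s == shift_of j)%:R.
Proof.
rewrite /var_a; case: leqP => sk.
  by rewrite mderivXU (inj_eq (@lshift_inj _ _)) inord_shiftE.
rewrite mderiv0; case: eqP => // e.
by have := shift_of_le j; rewrite -e leqNgt sk.
Qed.

Lemma mderiv_var_b_b k s (j : 'I_(k + k).+1) :
  (var_b C k s)^`M(idx_b j) = (s == shift_of j)%:R.
Proof.
rewrite /var_b; case: leqP => sk.
  by rewrite mderivXU (inj_eq (@rshift_inj _ _)) inord_shiftE.
rewrite mderiv0; case: eqP => // e.
by have := shift_of_le j; rewrite -e leqNgt sk.
Qed.

Lemma mderiv_var_a_b k s (j : 'I_(k + k).+1) : (var_a C k s)^`M(idx_b j) = 0.
Proof. by rewrite /var_a; case: ifP => _; rewrite ?mderiv0 // mderivXU eq_lrshift. Qed.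

Lemma mderiv_var_b_a k s (j : 'I_(k + k).+1) : (var_b C k s)^`M(idx_a j) = 0.
Proof. by rewrite /var_b; case: ifP => _; rewrite ?mderiv0 // mderivXU eq_rlshift. Qed.

Lemma density_at_jpow a b k l n m : (l <= k)%N ->
  density_at a b n (jpow (var_a C k) (var_b C k) l m 0) = jpow a b l (n + m) n.
Proof.
move=> lk; apply: (@iter_jacobi_morph _ _ _ _ _ a b n l k m) => // s sk.
  exact: density_at_var_a.
exact: density_at_var_b.
Qed.

(** The pair [(u, v)] covers both kinds of variable. Evaluating at [n - s] places the differentiated
    coefficient at site [n] for every [s], so that [s] survives only in the base point [n - s]. *)
Lemma density_at_mderiv_fhat_poly a b k l n (i : 'I_(nvar k)) (u v : C) s :
  (l <= k)%N -> (`|s| <= k)%N ->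
  (forall t, (var_a C k t)^`M(i) = u%:MP * (t == s)%:R) ->
  (forall t, (var_b C k t)^`M(i) = v%:MP * (t == s)%:R) ->
  density_at a b (n - s) (fhat_poly C k l)^`M(i) = \sum_(h < l)
    (u * (jpow a b h n (n - s) * jpow a b (l - h.+1) (n - s) (n + 1)
          + jpow a b h (n + 1) (n - s) * jpow a b (l - h.+1) (n - s) n)
     + v * (jpow a b h n (n - s) * jpow a b (l - h.+1) (n - s) n)).
Proof.
move=> lk sk Da Db; rewrite -[fhat_poly C k l]/(jpow _ _ l 0 0).
rewrite (jpow_derivation _ _ (mderivM i) Da Db) /density_at raddf_sum.
apply: eq_bigr => h _; have hl := ltn_ord h.
rewrite /= !(mevalD, mevalM) !mevalC -!/(density_at _ _ _ _).
rewrite !(jpow_sym _ _ h 0) !density_at_jpow ?addrA ?subrK //; try lia.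
by rewrite !(jpow_sym _ _ (l - h.+1) (n - s)).
Qed.

(** Summing over the base point glues [L ^ h] and [L ^ (l - h - 1)] into [L ^ (l - 1)], whatever the
    position [h] of the differentiated factor; there are [l] positions. *)
Lemma vder_b_fhat_poly a b k l n : (l <= k)%N ->
  vder_b (fhat_poly C k l) a b n = l%:R * jdiag a b l.-1 n.
Proof.
move=> lk; rewrite /vder_b; under eq_bigr => j _.
  have Da t : (var_a C k t)^`M(idx_b j) = (0 : C)%:MP * (t == shift_of j)%:R.
    by rewrite mul0r mderiv_var_a_b.
  have Db t : (var_b C k t)^`M(idx_b j) = (1 : C)%:MP * (t == shift_of j)%:R.
    by rewrite mul1r mderiv_var_b_b.
  rewrite (density_at_mderiv_fhat_poly _ _ _ lk (shift_of_le j) Da Db).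
  over.
rewrite exchange_big /= -[l in l%:R]card_ord -sum1_card natr_sum mulr_suml.
apply: eq_bigr => h _; have hl := ltn_ord h.
under eq_bigr do rewrite mul0r add0r mul1r.
by rewrite mul1r jpowD_window ?subrr; [congr jpow; lia | lia].
Qed.

(** As for [b], but [a n] occurs at both [(n, n + 1)] and [(n + 1, n)] in [L], which by symmetry
    gives the factor 2. *)
Lemma vder_a_fhat_poly a b k l n : (l <= k)%N ->
  vder_a (fhat_poly C k l) a b n = l%:R * (2%:R * jpow a b l.-1 n (n + 1)).
Proof.
move=> lk; rewrite /vder_a; under eq_bigr => j _.
  have Da t : (var_a C k t)^`M(idx_a j) = (1 : C)%:MP * (t == shift_of j)%:R.
    by rewrite mul1r mderiv_var_a_a.
  have Db t : (var_b C k t)^`M(idx_a j) = (0 : C)%:MP * (t == shift_of j)%:R.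
    by rewrite mul0r mderiv_var_b_a.
  rewrite (density_at_mderiv_fhat_poly _ _ _ lk (shift_of_le j) Da Db).
  over.
rewrite exchange_big /= -[l in l%:R]card_ord -sum1_card natr_sum mulr_suml.
apply: eq_bigr => h _; have hl := ltn_ord h.
under eq_bigr do rewrite mul0r addr0 mul1r.
(* Paths of length [h] from [n + 1] stay in the window since [h < l <= k]. *)
rewrite big_split /= !jpowD_window; try lia.
rewrite mul1r mulr_natl mulr2n (jpow_sym _ _ _ (n + 1)).
by congr (jpow _ _ _ _ _ + jpow _ _ _ _ _); lia.
Qed.

End VariationalDerivatives.

(** * Telescoping series over the integers *)

Lemma sum_fsetU (V : nmodType) (I : choiceType) (J J' : {fset I}) (F : I -> V) :
  [disjoint J & J']%fset ->
  \sum_(i <- (J `|` J')%fset) F i = \sum_(i <- J) F i + \sum_(i <- J') F i.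
Proof.
move=> /fdisjointP JJ'; rewrite (big_fsetID _ (mem J)) /=; congr (_ + _).
  by congr (\sum_(i <- _) F i); congr enum_fset; apply/fsetP => i;
    rewrite !inE /= andbC orbC; case: (i \in J); rewrite ?orbT.
congr (\sum_(i <- _) F i); congr enum_fset; apply/fsetP => i; rewrite !inE /=.
by have := JJ' i; case: (i \in J) => [/(_ isT)/negbTE ->|_]; rewrite ?andbF ?andbT.
Qed.

Section Telescoping.
Variable R : realType.
Implicit Types f t : int -> R[i].

Lemma sum_ReC f (J : {fset int}) :
  (\sum_(i <- J) complex.Re `|f i|)%:C%C = \sum_(i <- J) `|f i|.
Proof. by rewrite rmorph_sum; apply: eq_bigr => i _; exact: RRe_real. Qed.

Lemma ell1_abs_summable f : ell1 f -> abs_summable f.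
Proof.
rewrite /ell1 /summable => f1; exists (fine (\esum_(i in [set: int])
  `|(complex.Re `|f i|)%:E|)%E)%:C%C => J.
rewrite -sum_ReC lecR -lee_fin fineK; last first.
  by rewrite ge0_fin_numE //; apply: esum_ge0.
apply: esum_ge; exists [set` J]%classic; first by split.
rewrite fsbig_finite //= set_fsetK -sumEFin.
by apply: lee_sum => i _; rewrite lee_fin ler_norm.
Qed.

(** Take [J] whose sum of moduli is within [e] of the supremum over all finite sets: a disjoint [J']
    of sum at least [e] would exceed that supremum. *)
Lemma abs_summable_tail f (e : R[i]) : abs_summable f -> 0 < e ->
  exists J : {fset int}, forall J' : {fset int}, [disjoint J' & J]%fset ->
    \sum_(i <- J') `|f i| < e.
Proof.
(* The supremum is taken in [R]; [M] and [e] are real because they are comparable with 0. *)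
move=> [M fM] e0; pose N (J : {fset int}) := \sum_(i <- J) complex.Re `|f i|.
pose S := range N.
have NM J : N J <= complex.Re M.
  have MR : M \is Num.real.
    by apply: ger0_real; apply: le_trans (fM fset0); rewrite big_seq_fset0.
  by rewrite -lecR RRe_real // /N sum_ReC.
have hS : has_sup S.
  by split; [exists (N fset0), fset0 | exists (complex.Re M) => _ [J _ <-]].
have eR : e = (complex.Re e)%:C%C by rewrite RRe_real ?gtr0_real.
have e0R : 0 < complex.Re e by rewrite -ltcR -eR.
have [_ [J _ <-] NJ] := sup_adherent e0R hS.
exists J => J' J'J; rewrite eR -sum_ReC ltcR -/(N J').
have : N (J' `|` J)%fset <= sup S.
  by apply: ub_le_sup; [case: hS | exists (J' `|` J)%fset].
rewrite /N sum_fsetU //= -/(N J) -/(N J') => NU.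
by rewrite -(ltrD2r (N J)); apply: le_lt_trans NU _; rewrite -ltrBlDl.
Qed.

#[local] Existing Instance summability.totally_filter.

(* For [J] large, the partial sum over [J] is the difference of the sums of [t]
   over [J + 1] and [J], which agree off the tail of [t]. *)
Lemma telescoping_sum_cvg0 t : abs_summable t ->
  (summability.partial_sum ((fun n => t (n + 1) - t n) : int -> R[i]^o)
    @ summability.totally --> (0 : R[i]^o))%classic.
Proof.
move=> t1; apply/cvgrPdist_lt => e e0.
have [J Jt] := abs_summable_tail t1 (divr_gt0 e0 (ltr0Sn _ 1)).
have part (J' : {fset int}) : (J `<=` J')%fset ->
    `|\sum_(i <- J') t i - \sum_(i <- J) t i| < e / 2%:R.
  move=> JJ'; have /fsubsetDP[_ dJ] := fsubset_refl (J' `\` J)%fset.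
  apply: le_lt_trans (Jt _ dJ); rewrite fdisjoint_sym in dJ.
  rewrite -[in X in X - _](fsetID J J') (fsetIidPr JJ') sum_fsetU //.
  by rewrite addrAC subrr add0r; exact: ler_norm_sum.
(* This set forces both [J'] and its translate [J' + 1] to contain [J]. *)
exists (J `|` [fset (i - 1)%R | i in J])%fset => //= J' /fsubUsetP[JJ' J1J'].
rewrite sub0r normrN /summability.partial_sum.
rewrite -(big_seq_fsetE _ J' xpredT (fun n => t (n + 1) - t n)) sumrB.
have -> : \sum_(i <- J') t (i + 1) = \sum_(i <- [fset (i + 1)%R | i in J']%fset) t i.
  by rewrite big_imfset //= => i j _ _; exact: addIr.
have JJ1 : (J `<=` [fset (i + 1)%R | i in J'])%fset.
  apply/fsubsetP => i iJ; apply/imfsetP; exists (i - 1); last by rewrite subrK.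
  by apply: (fsubsetP J1J'); apply/imfsetP; exists i.
rewrite -(subrKA (\sum_(i <- J) t i)) [e]splitr.
apply: le_lt_trans (ler_normD _ _) _; rewrite ltrD ?part //.
by rewrite distrC part.
Qed.

Lemma sumZ_telescoping f t : abs_summable t ->
  (forall n, f n = t (n + 1) - t n) -> cvgZ f /\ sumZ f = 0.
Proof.
move=> t1 /funext ->; have c0 := telescoping_sum_cvg0 t1.
split; first by apply/cvg_ex; exists 0.
exact: (cvg_lim (@norm_hausdorff _ R[i]^o) c0).
Qed.

End Telescoping.

(** * The bracket of the functionals and their involution *)

Section Bracket.
Variable C : numFieldType.
Implicit Types (a b : int -> C).

Lemma vder_a_sum k (N : nat) (d : 'I_N -> C) (F : 'I_N -> density_poly C k) a b n :
  vder_a (\sum_j d j *: F j) a b n = \sum_j d j * vder_a (F j) a b n.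
Proof.
rewrite /vder_a /density_at; under eq_bigr do rewrite (raddf_sum (mderiv _)) raddf_sum /=.
rewrite exchange_big /=; apply: eq_bigr => j _; rewrite mulr_sumr.
by apply: eq_bigr => i _; rewrite mderivZ mevalZ.
Qed.

Lemma vder_b_sum k (N : nat) (d : 'I_N -> C) (F : 'I_N -> density_poly C k) a b n :
  vder_b (\sum_j d j *: F j) a b n = \sum_j d j * vder_b (F j) a b n.
Proof.
rewrite /vder_b /density_at; under eq_bigr do rewrite (raddf_sum (mderiv _)) raddf_sum /=.
rewrite exchange_big /=; apply: eq_bigr => j _; rewrite mulr_sumr.
by apply: eq_bigr => i _; rewrite mderivZ mevalZ.
Qed.

(** Expressing the gradient by entries of powers of [L] hides the order of the density and treats
    [p = -1] and [p >= 0] alike. *)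
Definition has_gradient (F : functional C) a b (N : nat) (d : 'I_N -> C)
    (e : 'I_N -> nat) :=
  (forall n, vder_a (density F) a b n =
     \sum_j d j * (2%:R * jpow a b (e j) n (n + 1))) /\
  (forall n, vder_b (density F) a b n = \sum_j d j * jdiag a b (e j) n).

(** Bilinearity: the factors [a] of the Poisson operator turn the entries [(n, n + 1)] into [K], and
    the 2 comes from the [a]-gradient. *)
Lemma bracket_term_jbracket (F1 F2 : functional C) a b (N1 N2 : nat)
    (d1 : 'I_N1 -> C) (e1 : 'I_N1 -> nat) (d2 : 'I_N2 -> C) (e2 : 'I_N2 -> nat) n :
  has_gradient F1 a b d1 e1 -> has_gradient F2 a b d2 e2 ->
  bracket_term F1 F2 a b n = \sum_i \sum_j
    2%:R * d1 i * d2 j * jbracket a b (e1 i) (e2 j) n.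
Proof.
move=> [a1 b1] [a2 b2]; rewrite /bracket_term !a1 !b1 !a2 !b2.
rewrite !mulr_sumr -!sumrB !big_distrlr -big_split; apply: eq_bigr => i _ /=.
rewrite -big_split; apply: eq_bigr => j _; rewrite /jbracket /joff /jdiag subrK /=.
by ring.
Qed.

End Bracket.

Lemma vder_fhat_poly_div (R : realType) k (q : nat) (a b : int -> R[i]) n :
  (q < k)%N ->
  vder_a (q.+1%:R^-1 *: fhat_poly R[i] k q.+1) a b n = 2%:R * jpow a b q n (n + 1) /\
  vder_b (q.+1%:R^-1 *: fhat_poly R[i] k q.+1) a b n = jdiag a b q n.
Proof.
pose F (_ : 'I_1) := fhat_poly R[i] k q.+1; move=> qk.
have := vder_a_sum (fun=> q.+1%:R^-1) F a b n.
have := vder_b_sum (fun=> q.+1%:R^-1) F a b n.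
rewrite !big_ord1 => -> ->; rewrite vder_a_fhat_poly // vder_b_fhat_poly //.
by rewrite !mulKf ?pnatr_eq0.
Qed.

Lemma Ifun_gradient (R : realType) (a b : int -> R[i]) (c : nat -> R[i]) (p : int) :
  -1 <= p -> exists N (d : 'I_N -> R[i]) (e : 'I_N -> nat),
    has_gradient (Ifun c p) a b d e.
Proof.
case: p => [m|[|//]] _.
  (* The summand of index [j] comes from [fhat] of degree [j + 2]; differentiation lowers the power
     to [j + 1]. *)
  exists m.+1, (fun j => c (m - j)%N), (fun j => j.+1).
  have E (j : 'I_m.+1) : Ihat_density R m.+2 j%:Z =
      j.+2%:R^-1 *: fhat_poly R[i] m.+2 j.+2.
    by rewrite /Ihat_density (_ : `|(j%:Z + 2)%R|%N = j.+2) //; lia.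
  split=> n /=.
    rewrite vder_a_sum; apply: eq_bigr => j _; rewrite E.
    by rewrite (vder_fhat_poly_div _ _ _ _).1 // ltnS ltn_ord.
  rewrite vder_b_sum; apply: eq_bigr => j _; rewrite E.
  by rewrite (vder_fhat_poly_div _ _ _ _).2 // ltnS ltn_ord.
exists 1%N, (fun=> 1), (fun=> 0%N).
split=> n; rewrite big_ord1 mul1r.
  by rewrite -(vder_fhat_poly_div (k := 1) _ _ _ _).1.
by rewrite -(vder_fhat_poly_div (k := 1) _ _ _ _).2.
Qed.

Theorem theorem5p7 (R : realType) (a b : int -> R[i])
    (a_bounded : ell_infty a) (b_bounded : ell_infty b)
    (a_neq0 : forall n : int, a n != 0)
    (a_ell1 : ell1 (fun n : int => a n ^+ 2 - 4%:R^-1))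
    (b_ell1 : ell1 b)
    (c : nat -> R[i]) (c0 : c 0%N = 1)
    (p r : int) (hp : -1 <= p) (hr : -1 <= r) :
  cvgZ (bracket_term (Ifun c p) (Ifun c r) a b) /\
  poisson_bracket (Ifun c p) (Ifun c r) a b = 0.
Proof.
have ha : ell1_const (fun n => a n ^+ 2).
  by exists 4%:R^-1; exact: ell1_abs_summable.
have hb : ell1_const b.
  exists 0; have := ell1_abs_summable b_ell1.
  by congr abs_summable; apply/funext => n; rewrite subr0.
have [N1 [d1 [e1 h1]]] := Ifun_gradient a b c hp.
have [N2 [d2 [e2 h2]]] := Ifun_gradient a b c hr.
(* The flux of the whole bracket; [T - lam] is summable and has the same differences as [T]. *)
pose T n := \sum_i \sum_j 2%:R * d1 i * d2 j * jflux a b (e1 i) (e2 j) n.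
have [lam Tlam] : ell1_const T.
  apply: ell1_const_sum => i; apply: ell1_const_sum => j.
  by apply: ell1_constM (ell1_const_cst _) (ell1_const_jflux ha hb _ _).
apply: sumZ_telescoping Tlam _ => n.
rewrite (bracket_term_jbracket _ h1 h2) opprB addrA subrK -sumrB /=.
apply: eq_bigr => i _; rewrite -sumrB; apply: eq_bigr => j _.
by rewrite jbracket_flux mulrBr.
Qed.
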